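(* Let $\mathcal{S}$ be an anti-negative semifield and $n$ a positive integer. If a bijective $\mathcal{S}$-linear transformation on $M_n(\mathcal{S})$ preserves any of $\mathcal{D}$, $\mathcal{J}$ and $\le_{\mathcal{J}}$, then it: (1) strongly preserves $\mathcal{D}$, $\mathcal{J}$, $\le_{\mathcal{J}}$ and $\mathcal{H}$; and (2) either strongly preserves $\mathcal{L}$, $\mathcal{R}$, $\le_{\mathcal{L}}$ and $\le_{\mathcal{R}}$, or else strongly exchanges $\mathcal{L}$ with $\mathcal{R}$ and strongly exchanges $\le_{\mathcal{L}}$ with $\le_{\mathcal{R}}$.
   Context: A semiring is a set $\mathcal{S}$ with addition and multiplication such that $\mathcal{S}$ is a commutative monoid under addition with identity $0_{\mathcal{S}}$, a semigroup under multiplication, multiplication distributes over addition on both sides, and $s0_{\mathcal{S}}=0_{\mathcal{S}}s=0_{\mathcal{S}}$ for all $s$. It is a semifield if $\mathcal{S}\setminus\{0_{\mathcal{S}}\}$ is an abelian group under multiplication (with identity $1_{\mathcal{S}}$). It is anti-negative if $a+b=0_{\mathcal{S}}$ implies $a=b=0_{\mathcal{S}}$. $M_n(\mathcal{S})$ is the set of $n\times n$ matrices over $\mathcal{S}$, viewed as a monoid under matrix multiplication and as an $\mathcal{S}$-module entrywise. $\mathcal{S}$-linear means additive and compatible with scalar multiplication. In the monoid $\mathcal{M}=M_n(\mathcal{S})$: $a\le_{\mathcal{R}} b$ iff $a=bs$ for some $s\in\mathcal{M}$; $a\le_{\mathcal{L}} b$ iff $a=sb$ for some $s\in\mathcal{M}$;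 $a\le_{\mathcal{J}} b$ iff $a=sbt$ for some $s,t\in\mathcal{M}$; for each of $\mathcal{K}=\mathcal{R},\mathcal{L},\mathcal{J}$, $a\,\mathcal{K}\,b$ iff $a\le_{\mathcal{K}}b$ and $b\le_{\mathcal{K}}a$; $a\,\mathcal{H}\,b$ iff $a\,\mathcal{R}\,b$ and $a\,\mathcal{L}\,b$; $a\,\mathcal{D}\,b$ iff there is $c\in\mathcal{M}$ with $a\,\mathcal{R}\,c$ and $c\,\mathcal{L}\,b$. For a map $T:M_n(\mathcal{S})\to M_n(\mathcal{S})$: $T$ preserves a relation $\mathcal{P}$ if $A\,\mathcal{P}\,B$ implies $T(A)\,\mathcal{P}\,T(B)$ for all $A,B$; $T$ strongly preserves $\mathcal{P}$ if $A\,\mathcal{P}\,B\iff T(A)\,\mathcal{P}\,T(B)$ for all $A,B$; $T$ strongly exchanges $\tau$ with $\rho$ if for all $x,y$ we have $x\,\tau\,y\iff T(x)\,\rho\,T(y)$ and $x\,\rho\,y\iff T(x)\,\tau\,T(y)$. *)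

(* Defs.v *)
From HB Require Import structures.
From mathcomp Require Import all_boot all_order all_algebra.

Set Implicit Arguments.
Unset Strict Implicit.
Unset Printing Implicit Defensive.

Import GRing.Theory.
Local Open Scope ring_scope.

(* [comNzSemiRingType] already provides a commutative multiplication with unit
   [1 != 0].  Given inverses, the nonzero elements are closed under
   multiplication and an inverse is nonzero, so this says exactly that they
   form an abelian group. *)
Definition is_semifield (S : comNzSemiRingType) : Prop :=
  forall a : S, a != 0 -> exists b : S, a * b = 1.

Definition antinegative (S : comNzSemiRingType) : Prop :=
  forall a b : S, a + b = 0 -> a = 0 /\ b = 0.

Section Green.

Variables (S : comNzSemiRingType) (n : nat).
Implicit Types A B C X Y : 'M[S]_n.

Definition green_leR A B : Prop := exists X, A = B *m X.
Definition green_leL A B : Prop := exists X, A = X *m B.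
Definition green_leJ A B : Prop := exists X Y, A = X *m B *m Y.

Definition green_R A B : Prop := green_leR A B /\ green_leR B A.
Definition green_L A B : Prop := green_leL A B /\ green_leL B A.
Definition green_J A B : Prop := green_leJ A B /\ green_leJ B A.
Definition green_H A B : Prop := green_R A B /\ green_L A B.
Definition green_D A B : Prop := exists C, green_R A C /\ green_L C B.

End Green.

Section Preservers.

Variable M : Type.
Implicit Types (T : M -> M) (P tau rho : M -> M -> Prop).

Definition preserves T P : Prop := forall A B, P A B -> P (T A) (T B).

Definition strongly_preserves T P : Prop :=
  forall A B, P A B <-> P (T A) (T B).

Definition strongly_exchanges T tau rho : Prop :=
  forall x y, (tau x y <-> rho (T x) (T y)) /\ (rho x y <-> tau (T x) (T y)).

End Preservers.

(* Main.v *)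
Require Import Defs.
From Corelib Require Import Setoid.
From HB Require Import structures.
From mathcomp Require Import all_boot all_order all_algebra.
From mathcomp Require Import perm.

(** Over an anti-negative semifield the only invertible matrices are the
    monomial ones, and this applies to [T] itself, seen as an invertible map of
    the free module with basis the matrix units: [T] sends each matrix unit to
    a nonzero multiple of a matrix unit, hence induces a permutation [f] of the
    [n * n] positions ([bij_linear_monomial]).

    The hypothesis on [T] is used only through matrices of rank one, that is
    products [x *m y] of a nonzero column and a nonzero row.  They form a
    single [D]-class and a single [J]-class ([rank1_D], [rank1_J]), and this
    class contains the matrix units, which [T] maps to multiples of matrix
    units.  So each of the three hypotheses implies that [T] preserves rank one
    ([preserves_rank1]).

    The support of a matrix of rank one is a rectangle.  Since the sum of two
    distinct matrix units has rank one exactly when they share a row or a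
    column, [f] preserves collinearity of positions, so that it is an
    automorphism of the rook's graph: it permutes rows and columns separately,
    up to transposition ([collinear_perm]).  The image of the all-ones matrix
    has rank one too, and its entries are the coefficients of [T]; they
    therefore factor as a function of the row times a function of the column.
    Altogether [T A] is [P *m A *m Q] or [P *m A^T *m Q] with [P] and [Q]
    invertible monomial matrices ([rank1_preserver_form]).

    Multiplication by invertible matrices respects all Green relations in both
    directions, and transposition exchanges left and right.  The two-sided
    relations are composites of a left and a right one, in either order, hence
    are insensitive to this exchange. *)

Set Implicit Arguments.
Unset Strict Implicit.
Unset Printing Implicit Defensive.

Import GRing.Theory.
Local Open Scope ring_scope.

(** * Green relations under equivalence and transposition *)

Section GreenRelations.

Variables (S : comNzSemiRingType) (n : nat).
Implicit Types (A B C P Q : 'M[S]_n) (T : 'M[S]_n -> 'M[S]_n).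

Lemma green_leR_tr A B : green_leR A^T B^T <-> green_leL A B.
Proof.
split=> -[X eA]; exists X^T; last by rewrite eA trmx_mul.
by rewrite -[A]trmxK eA trmx_mul trmxK.
Qed.

Lemma green_leL_tr A B : green_leL A^T B^T <-> green_leR A B.
Proof. by have := green_leR_tr A^T B^T; rewrite !trmxK => -[? ?]. Qed.

Lemma green_leJ_RL A B :
  green_leJ A B <-> exists C, green_leR A C /\ green_leL C B.
Proof.
split=> [[X [Y ->]] | [_ [[Y ->] [X ->]]]]; last by exists X, Y.
by exists (X *m B); split; [exists Y | exists X].
Qed.

Lemma green_leJ_LR A B :
  green_leJ A B <-> exists C, green_leL A C /\ green_leR C B.
Proof.
split=> [[X [Y ->]] | [_ [[X ->] [Y ->]]]].
  by exists (B *m Y); split; [exists X; rewrite mulmxA | exists Y].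
by exists X, Y; rewrite mulmxA.
Qed.

(** The relations [R] and [L] commute because left and right multiplications
    do. *)
Lemma green_D_LR A B : green_D A B <-> exists C, green_L A C /\ green_R C B.
Proof.
split=> -[C].
  move=> [[[X eA] [Y eC]] [[Z eCB] [W eB]]]; exists (W *m A).
  do 2!split; [exists Z | by exists W | exists X | exists Y].
  - by rewrite {2}eA !mulmxA -(mulmxA Z) -eB -eCB -eA.
  - by rewrite {1}eA mulmxA -eB.
  - by rewrite -mulmxA -eC.
move=> [[[X eA] [Y eC]] [[Z eCB] [W eB]]]; exists (A *m W).
do 2!split; [exists Z | by exists W | exists X | exists Y].
- by rewrite {2}eA -!mulmxA (mulmxA C) -eB -eCB -eA.
- by rewrite {1}eA -mulmxA -eB.
- by rewrite mulmxA -eC.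
Qed.

Lemma green_D_sub_J A B : green_D A B -> green_J A B.
Proof.
move=> [C [[AC CA] [CB BC]]]; split; first by apply/green_leJ_RL; exists C.
by apply/green_leJ_LR; exists C.
Qed.

Lemma iff_ex_image T (p q : 'M[S]_n -> Prop) :
  (forall B, exists A, T A = B) -> (forall A, p A <-> q (T A)) ->
  (exists A, p A) <-> (exists B, q B).
Proof.
move=> T_onto pq; split=> [[A /pq qA] | [B qB]]; first by exists (T A).
by have [A eB] := T_onto B; exists A; apply/pq; rewrite eB.
Qed.

Lemma strongly_preserves_green T :
    (forall B, exists A, T A = B) ->
    strongly_preserves T (@green_leL S n) ->
    strongly_preserves T (@green_leR S n) ->
  (strongly_preserves T (@green_D S n)
   /\ strongly_preserves T (@green_J S n)
   /\ strongly_preserves T (@green_leJ S n)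
   /\ strongly_preserves T (@green_H S n))
  /\ (strongly_preserves T (@green_L S n)
      /\ strongly_preserves T (@green_R S n)).
Proof.
move=> T_onto TleL TleR.
have TL A B : green_L A B <-> green_L (T A) (T B).
  by rewrite /green_L -!TleL.
have TR A B : green_R A B <-> green_R (T A) (T B).
  by rewrite /green_R -!TleR.
have TleJ A B : green_leJ A B <-> green_leJ (T A) (T B).
  rewrite !green_leJ_RL; apply: iff_ex_image T_onto _ => C.
  by rewrite TleR TleL.
have TD A B : green_D A B <-> green_D (T A) (T B).
  by apply: iff_ex_image T_onto _ => C; rewrite TR TL.
split=> //; split=> //; split; first by move=> A B; rewrite /green_J -!TleJ.
by split=> // A B; rewrite /green_H -TR -TL.
Qed.

Lemma strongly_exchanges_green T :
    (forall B, exists A, T A = B) ->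
    strongly_exchanges T (@green_leL S n) (@green_leR S n) ->
  (strongly_preserves T (@green_D S n)
   /\ strongly_preserves T (@green_J S n)
   /\ strongly_preserves T (@green_leJ S n)
   /\ strongly_preserves T (@green_H S n))
  /\ strongly_exchanges T (@green_L S n) (@green_R S n).
Proof.
move=> T_onto Tle.
have TleL A B : green_leL A B <-> green_leR (T A) (T B) by case: (Tle A B).
have TleR A B : green_leR A B <-> green_leL (T A) (T B) by case: (Tle A B).
have TL A B : green_L A B <-> green_R (T A) (T B).
  by rewrite /green_L /green_R -!TleL.
have TR A B : green_R A B <-> green_L (T A) (T B).
  by rewrite /green_R /green_L -!TleR.
have TleJ A B : green_leJ A B <-> green_leJ (T A) (T B).
  rewrite green_leJ_RL green_leJ_LR; apply: iff_ex_image T_onto _ => C.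
  by rewrite -TleR -TleL.
have TD A B : green_D A B <-> green_D (T A) (T B).
  rewrite green_D_LR; apply: iff_ex_image T_onto _ => C.
  by rewrite -TR -TL.
split; last by move=> A B.
split=> //; split; first by move=> A B; rewrite /green_J -!TleJ.
by split=> // A B; rewrite /green_H -TR -TL; split=> -[? ?].
Qed.

Definition invertible P := exists P', P *m P' = 1%:M /\ P' *m P = 1%:M.

Lemma invertible_mul P Q : invertible P -> invertible Q -> invertible (P *m Q).
Proof.
move=> [P' [PP' P'P]] [Q' [QQ' Q'Q]]; exists (Q' *m P'); split.
  by rewrite mulmxA -(mulmxA P) QQ' mulmx1.
by rewrite mulmxA -(mulmxA Q') P'P mulmx1.
Qed.

Lemma invertible_perm (s : 'S_n) : invertible (perm_mx s).
Proof.
by exists (perm_mx s^-1); rewrite -!perm_mxM mulgV mulVg perm_mx1.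
Qed.

Lemma green_leR_equivalence P Q A B : invertible P -> invertible Q ->
  green_leR A B <-> green_leR (P *m A *m Q) (P *m B *m Q).
Proof.
move=> [P' [_ P'P]] [Q' [QQ' _]]; split=> -[X eA].
  exists (Q' *m X *m Q).
  by rewrite eA !mulmxA -(mulmxA (P *m B) Q) QQ' mulmx1.
exists (Q *m X *m Q').
rewrite -[A]mul1mx -P'P -[LHS]mulmx1 -QQ' !mulmxA -2!(mulmxA P') eA.
by rewrite !mulmxA P'P mul1mx.
Qed.

Lemma invertible_tr P : invertible P -> invertible P^T.
Proof.
by case=> P' [e1 e2]; exists P'^T; rewrite -!trmx_mul e1 e2 trmx1.
Qed.

Lemma green_leL_equivalence P Q A B : invertible P -> invertible Q ->
  green_leL A B <-> green_leL (P *m A *m Q) (P *m B *m Q).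
Proof.
move=> /invertible_tr iP /invertible_tr iQ.
rewrite -green_leR_tr -(green_leR_tr (P *m A *m Q)) !trmx_mul !mulmxA.
exact: green_leR_equivalence.
Qed.

End GreenRelations.

(** * Positions of a square grid and their collinearity *)

Section Collinear.

Variable n : nat.
Implicit Types p q : 'I_n * 'I_n.

Definition collinear p q := (p.1 == q.1) || (p.2 == q.2).

Definition swap p := (p.2, p.1).

Lemma collinear_swap p q : collinear (swap p) (swap q) = collinear p q.
Proof. exact: orbC. Qed.

Lemma swap_inj : injective swap.
Proof. by move=> [a b] [c d] [-> ->]. Qed.

(** A row of [n] positions sent injectively into one row fills it. *)
Lemma row_image_full (f : 'I_n * 'I_n -> 'I_n * 'I_n) i k c :
    injective f -> (forall j, (f (i, j)).1 = k) ->
  exists j, f (i, j) = (k, c).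
Proof.
move=> f_inj fi1.
have g_inj : injective (fun j => (f (i, j)).2).
  move=> j j' ej; suff [] : (i, j) = (i, j') by [].
  by apply: f_inj; apply: injective_projections; rewrite ?fi1.
have /codomP[j ->] := injF_onto g_inj c.
by exists j; rewrite -(fi1 j) -surjective_pairing.
Qed.

Lemma row_to_row_perm (f : 'I_n * 'I_n -> 'I_n * 'I_n) (j0 : 'I_n) :
    injective f -> (forall p q, collinear p q -> collinear (f p) (f q)) ->
    (forall i j k, (f (i, j)).1 = (f (i, k)).1) ->
  exists s t : 'S_n, forall i j, f (i, j) = (s i, t j).
Proof.
move=> f_inj f_col f_row.
have s_inj : injective (fun i => (f (i, j0)).1).
  move=> i i' /= ei.
  have [j ej] : exists j, f (i, j) = f (i', j0).
    by rewrite [f (i', j0)]surjective_pairing -ei; apply: row_image_full.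
  by case: (f_inj _ _ ej).
have f_col2 i i' j : (f (i, j)).2 = (f (i', j)).2.
  have [-> // | ne_i] := eqVneq i i'.
  have /orP[/eqP e1 | /eqP //] : collinear (f (i, j)) (f (i', j)).
    by apply: f_col; rewrite /collinear eqxx orbT.
  case/eqP: ne_i; apply: s_inj.
  by rewrite (f_row i j0 j) (f_row i' j0 j).
have t_inj : injective (fun j => (f (j0, j)).2).
  move=> j j' ej; suff [] : (j0, j) = (j0, j') by [].
  by apply: f_inj; apply: injective_projections.
exists (perm s_inj), (perm t_inj) => i j; rewrite !permE.
by rewrite -(f_row i j) (f_col2 j0 i) -surjective_pairing.
Qed.

(** The automorphisms of the rook's graph.  The image of a row is a clique of
    [n] positions, so it lies in a row or in a column, and fills it; an image
    row and an image column would meet, against injectivity, so that all rows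
    behave alike. *)
Lemma collinear_perm (f : 'I_n * 'I_n -> 'I_n * 'I_n) (i0 : 'I_n) :
    injective f -> (forall p q, collinear p q -> collinear (f p) (f q)) ->
  exists s t : 'S_n, (forall i j, f (i, j) = (s i, t j))
                  \/ (forall i j, f (i, j) = (t j, s i)).
Proof.
move=> f_inj f_col.
pose g p := swap (f p).
have g_inj : injective g by apply: inj_comp f_inj; apply: swap_inj.
have g_col p q : collinear p q -> collinear (g p) (g q).
  by rewrite collinear_swap; apply: f_col.
pose to_row i := [forall j, forall k, (f (i, j)).1 == (f (i, k)).1].
have to_rowP i : to_row i -> forall j k, (f (i, j)).1 = (f (i, k)).1.
  by move=> /forallP h j k; have /forallP/(_ k)/eqP := h j.
have to_colP i : ~~ to_row i -> forall j k, (f (i, j)).2 = (f (i, k)).2.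
  case/forallPn=> j /forallPn[k ne1].
  have fi l m : collinear (f (i, l)) (f (i, m)).
    by apply: f_col; rewrite /collinear eqxx.
  have ejk : (f (i, j)).2 = (f (i, k)).2.
    by have /orP[e1 | /eqP //] := fi j k; rewrite e1 in ne1.
  suff h l : (f (i, l)).2 = (f (i, j)).2 by move=> l m; rewrite !h.
  have /orP[/eqP elj | /eqP //] := fi l j.
  have /orP[/eqP elk | /eqP ->] := fi l k; last by rewrite ejk.
  by case/eqP: ne1; rewrite -elj.
have [/forallP all_row | /forallPn[i col_i]] := boolP [forall i, to_row i].
  have [s [t fE]] :=
    row_to_row_perm i0 f_inj f_col (fun i => to_rowP i (all_row i)).
  by exists s, t; left.
have all_col i' : forall j k, (g (i', j)).1 = (g (i', k)).1.
  have [row_i' | ] := boolP (to_row i'); last exact: to_colP.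
  have [j ej] : exists j, f (i', j) = ((f (i', i0)).1, (f (i, i0)).2).
    by apply: row_image_full => // j; apply: to_rowP.
  have [k ek] : exists k, g (i, k) = ((f (i, i0)).2, (f (i', i0)).1).
    by apply: row_image_full => // k; apply: to_colP.
  have [eii' _] : (i', j) = (i, k).
    by apply: g_inj; rewrite ek /g ej.
  by rewrite eii' in row_i'; rewrite row_i' in col_i.
have [s [t gE]] := row_to_row_perm i0 g_inj g_col all_col.
exists s, t; right=> k l.
by apply: swap_inj; apply: gE.
Qed.

End Collinear.

(** * Matrices of rank one and their linear preservers *)

Section Semifield.

Variable S : comNzSemiRingType.
Hypothesis S_semifield : is_semifield S.

Lemma semifield_mulf_neq0 (a b : S) : a != 0 -> b != 0 -> a * b != 0.
Proof.
move=> /S_semifield[a' aa'] b0; apply: contraNneq b0 => ab0.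
by rewrite -[b]mul1r -aa' mulrAC ab0 mul0r.
Qed.

Variable n : nat.
Implicit Types (A B : 'M[S]_n) (x : 'cV[S]_n) (y : 'rV[S]_n).

Lemma semifield_row_rinv y : y != 0 -> exists x, y *m x = 1%:M.
Proof.
case/matrix0Pn=> i [j]; rewrite ord1 => /S_semifield[b eb].
exists (b *: delta_mx j 0); rewrite -scalemxAr -colE.
by apply/matrixP=> k l; rewrite !ord1 !mxE mulrC.
Qed.

Lemma semifield_col_linv x : x != 0 -> exists y, y *m x = 1%:M.
Proof.
rewrite -trmx_eq0 => /semifield_row_rinv[y xy]; exists y^T.
by apply: trmx_inj; rewrite trmx_mul trmxK xy trmx1.
Qed.

Definition rank1 A := exists x y, [/\ x != 0, y != 0 & A = x *m y].

Lemma mulmx_outerE x y i j : (x *m y) i j = x i 0 * y 0 j.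
Proof. by rewrite mxE big_ord1. Qed.

Lemma rank1_support A i j k l :
  rank1 A -> A i j != 0 -> A k l != 0 -> A i l != 0.
Proof.
move=> [x [y [_ _ ->]]]; rewrite !mulmx_outerE => xy_ij xy_kl.
apply: semifield_mulf_neq0.
  by apply: contraNneq xy_ij => ->; rewrite mul0r.
by apply: contraNneq xy_kl => ->; rewrite mulr0.
Qed.

Lemma rank1_neq0 A : rank1 A -> A != 0.
Proof.
move=> [x [y [/matrix0Pn[i [k xi]] /matrix0Pn[l [j yj]] ->]]].
rewrite !ord1 in xi yj; apply/matrix0Pn; exists i, j.
by rewrite mulmx_outerE; apply: semifield_mulf_neq0.
Qed.

(** For [A = x *m y] and [B = u *m v], the matrix [x *m v] has the column space
    of [A] and the row space of [B]. *)
Lemma rank1_D A B : rank1 A -> rank1 B -> green_D A B.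
Proof.
move=> [x [y [x0 y0 ->]]] [u [v [u0 v0 ->]]].
have [x' xK] := semifield_col_linv x0; have [u' uK] := semifield_col_linv u0.
have [y' yK] := semifield_row_rinv y0; have [v' vK] := semifield_row_rinv v0.
exists (x *m v); do 2!split.
- by exists (v' *m y); rewrite mulmxA -(mulmxA x) vK mulmx1.
- by exists (y' *m v); rewrite mulmxA -(mulmxA x) yK mulmx1.
- by exists (x *m u'); rewrite mulmxA -(mulmxA x) uK mulmx1.
- by exists (u *m x'); rewrite mulmxA -(mulmxA u) xK mulmx1.
Qed.

Lemma rank1_leJ A B : rank1 B -> green_leJ A B -> A != 0 -> rank1 A.
Proof.
move=> [x [y [_ _ ->]]] [X [Y ->]]; rewrite mulmxA -(mulmxA (X *m x)) => nz.
exists (X *m x), (y *m Y); split=> //.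
  by apply: contraNneq nz => ->; rewrite mul0mx.
by apply: contraNneq nz => ->; rewrite mulmx0.
Qed.

Lemma rank1_J A B : rank1 B -> green_J A B -> rank1 A.
Proof.
move=> rB [AB [X [Y eB]]]; apply: (rank1_leJ rB AB).
by apply: contraNneq (rank1_neq0 rB) => A0; rewrite eB A0 mulmx0 mul0mx.
Qed.

Lemma delta_pairE (p q : 'I_n * 'I_n) :
  (delta_mx p.1 p.2 : 'M[S]_n) q.1 q.2 = (q == p)%:R.
Proof. by case: p q => [i j] [k l]; rewrite mxE. Qed.

Lemma delta_col_neq0 (i : 'I_n) : delta_mx i 0 != 0 :> 'cV[S]_n.
Proof. by apply/matrix0Pn; exists i, 0; rewrite mxE !eqxx oner_eq0. Qed.

Lemma delta_row_neq0 (j : 'I_n) : delta_mx 0 j != 0 :> 'rV[S]_n.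
Proof. by apply/matrix0Pn; exists 0, j; rewrite mxE !eqxx oner_eq0. Qed.

Lemma rank1_scale_delta a (i j : 'I_n) : a != 0 -> rank1 (a *: delta_mx i j).
Proof.
move=> a0; exists (a *: delta_mx i 0), (delta_mx 0 j); split.
- apply/matrix0Pn; exists i, 0; rewrite !mxE !eqxx mulr1 //.
- exact: delta_row_neq0.
- by rewrite -scalemxAl mul_delta_mx.
Qed.

Lemma rank1_delta (i j : 'I_n) : rank1 (delta_mx i j : 'M[S]_n).
Proof. by rewrite -[delta_mx i j]scale1r; apply/rank1_scale_delta/oner_neq0. Qed.

Lemma rank1_tr A : rank1 A -> rank1 A^T.
Proof.
move=> [x [y [x0 y0 ->]]]; exists y^T, x^T.
by rewrite !trmx_eq0 trmx_mul.
Qed.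

Lemma rank1_delta_rowD (i j k : 'I_n) :
  j != k -> rank1 (delta_mx i j + delta_mx i k : 'M[S]_n).
Proof.
move=> ne_jk; exists (delta_mx i 0), (delta_mx 0 j + delta_mx 0 k).
rewrite mulmxDr !mul_delta_mx; split=> //; first exact: delta_col_neq0.
apply/matrix0Pn; exists 0, j.
by rewrite !mxE !eqxx (negPf ne_jk) addr0 oner_eq0.
Qed.

(** Distinctness excludes twice a matrix unit, which is zero over a semifield
    of characteristic two. *)
Lemma rank1_collinearD (p q : 'I_n * 'I_n) : p != q -> collinear p q ->
  rank1 (delta_mx p.1 p.2 + delta_mx q.1 q.2 : 'M[S]_n).
Proof.
case: p q => [i j] [k l] /= ne_pq /orP[/= /eqP e | /= /eqP e].
  by subst k; apply: rank1_delta_rowD; apply: contraNneq ne_pq => ->.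
subst l; rewrite -[_ + _]trmxK linearD /= !trmx_delta; apply/rank1_tr.
by apply: rank1_delta_rowD; apply: contraNneq ne_pq => ->.
Qed.

Lemma invertible_diag (d : 'rV[S]_n) :
  (forall i, d 0 i != 0) -> invertible (diag_mx d).
Proof.
move=> d0; have [b db] := fin_all_exists (fun i => S_semifield (d0 i)).
exists (diag_mx (\row_i b i)); rewrite diag_mxC; split.
  all: rewrite mul_diag_mx; apply/matrixP=> i j; rewrite !mxE.
  all: by rewrite mulrnAr mulrC db.
Qed.

Lemma monomial_mulE (s t : 'S_n) (x y : 'rV[S]_n) A B :
    (forall i j, B (s i) (t j) = x 0 (s i) * A i j * y 0 (t j)) ->
  B = (diag_mx x *m perm_mx s^-1) *m A *m (perm_mx t *m diag_mx y).
Proof.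
move=> BE; rewrite -(mulmxA (diag_mx x)) -row_permE.
rewrite -[t]invgK !mulmxA -(mulmxA (diag_mx x)) -col_permE.
rewrite mul_diag_mx mul_mx_diag; apply/matrixP=> i j; rewrite !mxE.
by rewrite -{1}[i](permKV s) -{1}[j](permKV t) BE !permKV.
Qed.

Hypothesis S_antineg : antinegative S.

(** If [T E] has a nonzero entry [a] at [(k, l)], anti-negativity makes the
    preimage of [a *: delta_mx k l], which is a summand of the matrix unit [E],
    a multiple of [E]; dividing by the factor, [T E] is a multiple of
    [delta_mx k l]. *)
Lemma bij_linear_delta (T : {linear 'M[S]_n -> 'M[S]_n}) (p : 'I_n * 'I_n) :
    bijective T ->
  exists qc : ('I_n * 'I_n) * S, qc.2 != 0
    /\ T (delta_mx p.1 p.2) = qc.2 *: delta_mx qc.1.1 qc.1.2.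
Proof.
move=> [g gK Kg]; set E := delta_mx _ _.
have : T E != 0.
  have := rank1_neq0 (rank1_delta p.1 p.2); apply: contraNneq => TE0.
  by apply/eqP; rewrite -[delta_mx _ _]gK TE0 -{1}(linear0 T) gK.
case/matrix0Pn=> k [l a0]; set a := T E k l in a0.
pose B := \matrix_(i, j) (if (i == k) && (j == l) then 0 else T E i j).
have TE : T E = a *: delta_mx k l + B.
  apply/matrixP=> i j; rewrite !mxE; case: ifP => [/andP[/eqP-> /eqP->] |].
    by rewrite mulr1 addr0.
  by rewrite mulr0 add0r.
pose U := g (a *: delta_mx k l).
have UE : U + g B = E.
  by apply: (can_inj gK); rewrite linearD /= !Kg TE.
pose u := U p.1 p.2.
have eU : U = u *: E.
  apply/matrixP=> i j; rewrite !mxE; case: eqP => [-> | ne]; last first.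
    have /matrixP/(_ i j) := UE; rewrite !mxE; case: eqP => // _ /S_antineg[-> _].
    by rewrite mulr0.
  case: eqP => [-> | ne]; rewrite ?mulr1 //.
  have /matrixP/(_ p.1 j) := UE; rewrite !mxE; case: (j =P p.2) => // _.
  by rewrite andbF => /S_antineg[-> _]; rewrite mulr0.
have uTE : u *: T E = a *: delta_mx k l by rewrite -linearZ -eU Kg.
have /S_semifield[u' uu'] : u != 0.
  apply: contraNneq (rank1_neq0 (rank1_scale_delta k l a0)) => u0.
  by rewrite -uTE u0 scale0r.
have u'0 : u' != 0.
  by apply: contraTneq (oner_neq0 S) => u'0; rewrite -uu' u'0 mulr0 eqxx.
exists ((k, l), u' * a); split=> /=; first exact: semifield_mulf_neq0.
by rewrite -scalerA -uTE scalerA mulrC uu' scale1r.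
Qed.

Lemma bij_linear_monomial (T : {linear 'M[S]_n -> 'M[S]_n}) :
    bijective T ->
  exists (f : 'I_n * 'I_n -> 'I_n * 'I_n) (c : 'I_n * 'I_n -> S),
    [/\ injective f, forall p, c p != 0
      & forall A p, T A (f p).1 (f p).2 = c p * A p.1 p.2].
Proof.
move=> T_bij.
have [fc fcP] := fin_all_exists (fun p => bij_linear_delta p T_bij).
have f_inj : injective (fun p => (fc p).1).
  move=> p q epq; have [[cp0 Tp] [cq0 Tq]] := (fcP p, fcP q).
  have : (fc q).2 *: delta_mx p.1 p.2 = (fc p).2 *: delta_mx q.1 q.2 :> 'M[S]_n.
    apply: (bij_inj T_bij); rewrite !linearZ /= Tp Tq epq !scalerA.
    by rewrite mulrC.
  move/matrixP/(_ p.1 p.2); rewrite mxE [RHS]mxE !delta_pairE eqxx mulr1.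
  case: eqP => [// | _ eq0]; by rewrite eq0 mulr0 eqxx in cq0.
exists (fun p => (fc p).1), (fun p => (fc p).2); split=> //.
  by move=> p; case: (fcP p).
move=> A p; rewrite {1}[A]matrix_sum_delta pair_bigA linear_sum summxE.
rewrite (bigD1 p) //= big1 => [|q ne_qp].
  by rewrite linearZ /= (fcP p).2 2!mxE delta_pairE eqxx mulr1 addr0 mulrC.
rewrite linearZ /= (fcP q).2 2!mxE delta_pairE (inj_eq f_inj) eq_sym.
by rewrite (negPf ne_qp) !mulr0.
Qed.

Lemma rank1_preserver_form (T : {linear 'M[S]_n -> 'M[S]_n}) (i0 : 'I_n) :
    bijective T -> (forall A, rank1 A -> rank1 (T A)) ->
  exists P Q : 'M[S]_n, [/\ invertible P, invertible Q
    & (forall A, T A = P *m A *m Q) \/ (forall A, T A = P *m A^T *m Q)].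
Proof.
move=> T_bij T_rank1.
have [f [c [f_inj c0 TE]]] := bij_linear_monomial T_bij.
have f_col p q : collinear p q -> collinear (f p) (f q).
  have [-> | ne_pq col_pq] := eqVneq p q; first by move=> _; rewrite /collinear eqxx.
  set E : 'M[S]_n := delta_mx p.1 p.2 + delta_mx q.1 q.2.
  have rTE : rank1 (T E) by apply/T_rank1/rank1_collinearD.
  have Ep : E p.1 p.2 != 0.
    by rewrite mxE !delta_pairE eqxx (negPf ne_pq) addr0 oner_eq0.
  have Eq : E q.1 q.2 != 0.
    by rewrite mxE !delta_pairE eqxx (eq_sym q) (negPf ne_pq) add0r oner_eq0.
  have TEp : T E (f p).1 (f p).2 != 0 by rewrite TE semifield_mulf_neq0.
  have TEq : T E (f q).1 (f q).2 != 0 by rewrite TE semifield_mulf_neq0.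
  (* The corner of the rectangle in the row of f p and the column of f q is
     nonzero in T E, so it is one of f p and f q. *)
  have := rank1_support rTE TEp TEq.
  have /codomP[z ez] := injF_onto f_inj ((f p).1, (f q).2).
  have [e1 e2] : (f p).1 = (f z).1 /\ (f q).2 = (f z).2 by rewrite -ez.
  rewrite {1}e1 {1}e2 TE /collinear => TEz.
  have : E z.1 z.2 != 0 by apply: contraNneq TEz => ->; rewrite mulr0.
  rewrite mxE !delta_pairE; have [zp _ | _] := eqVneq z p.
    by rewrite e2 zp eqxx orbT.
  have [zq _ | _] := eqVneq z q; last by rewrite addr0 eqxx.
  by rewrite e1 zq eqxx.
(* The entries of the image of the all-ones matrix are the c p. *)
have [x [y [_ _ cE]]] : rank1 (T (const_mx 1)).
  apply: T_rank1; exists (const_mx 1), (const_mx 1); split.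
  - by apply/matrix0Pn; exists i0, 0; rewrite mxE oner_eq0.
  - by apply/matrix0Pn; exists 0, i0; rewrite mxE oner_eq0.
  - by apply/matrixP=> i j; rewrite mulmx_outerE !mxE mulr1.
have {}cE p : c p = x (f p).1 0 * y 0 (f p).2.
  by rewrite -mulmx_outerE -cE TE mxE mulr1.
have xy0 i j : x i 0 * y 0 j != 0.
  have /codomP[p ep] := injF_onto f_inj (i, j).
  by have := c0 p; rewrite cE -ep.
have x0 i : x^T 0 i != 0.
  by rewrite mxE; apply: contraNneq (xy0 i i) => ->; rewrite mul0r.
have y0 i : y 0 i != 0 by apply: contraNneq (xy0 i i) => ->; rewrite mulr0.
have [s [t fE]] := collinear_perm i0 f_inj f_col.
case: fE => fE.
  exists (diag_mx x^T *m perm_mx s^-1), (perm_mx t *m diag_mx y).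
  split; [| |left=> A].
  - by apply: invertible_mul; [apply: invertible_diag | apply: invertible_perm].
  - by apply: invertible_mul; [apply: invertible_perm | apply: invertible_diag].
  - apply: monomial_mulE => i j; have := TE A (i, j).
    by rewrite cE fE /= => ->; rewrite mxE mulrAC.
exists (diag_mx x^T *m perm_mx t^-1), (perm_mx s *m diag_mx y).
split; [| |right=> A].
- by apply: invertible_mul; [apply: invertible_diag | apply: invertible_perm].
- by apply: invertible_mul; [apply: invertible_perm | apply: invertible_diag].
- apply: monomial_mulE => j i; have := TE A (i, j).
  by rewrite cE fE /= => ->; rewrite !mxE mulrAC.
Qed.

Lemma preserves_rank1 (T : {linear 'M[S]_n -> 'M[S]_n}) :
    bijective T ->
    preserves T (@green_D S n) \/ preserves T (@green_J S n)
    \/ preserves T (@green_leJ S n) ->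
  forall A, rank1 A -> rank1 (T A).
Proof.
move=> T_bij T_pres A rA.
have [i _] : exists i : 'I_n, true.
  by have /matrix0Pn[i _] := rank1_neq0 rA; exists i.
pose E : 'M[S]_n := delta_mx i i.
have rTE : rank1 (T E).
  have [[q c] [c0 ->]] := bij_linear_delta (i, i) T_bij.
  exact: rank1_scale_delta.
have DAE : green_D A E by apply: rank1_D rA _; apply: rank1_delta.
have [AE EA] := green_D_sub_J DAE.
apply: rank1_J rTE _; case: T_pres => [TD | [TJ | TleJ]].
- exact/green_D_sub_J/TD.
- exact: TJ.
- by split; apply: TleJ.
Qed.

End Semifield.

Theorem corollary3p7 (S : comNzSemiRingType) (n : nat)
    (S_semifield : is_semifield S) (S_antineg : antinegative S)
    (n_gt0 : (0 < n)%N)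
    (T : {linear 'M[S]_n -> 'M[S]_n}) (T_bij : bijective T)
    (T_pres : preserves T (@green_D S n) \/ preserves T (@green_J S n)
              \/ preserves T (@green_leJ S n)) :
  (strongly_preserves T (@green_D S n)
   /\ strongly_preserves T (@green_J S n)
   /\ strongly_preserves T (@green_leJ S n)
   /\ strongly_preserves T (@green_H S n))
  /\
  ((strongly_preserves T (@green_L S n)
    /\ strongly_preserves T (@green_R S n)
    /\ strongly_preserves T (@green_leL S n)
    /\ strongly_preserves T (@green_leR S n))
   \/
   (strongly_exchanges T (@green_L S n) (@green_R S n)
    /\ strongly_exchanges T (@green_leL S n) (@green_leR S n))).
Proof.
have T_rank1 := preserves_rank1 S_semifield S_antineg T_bij T_pres.
have [P [Q [iP iQ T_form]]] :=
  rank1_preserver_form S_semifield S_antineg (Ordinal n_gt0) T_bij T_rank1.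
have T_onto B : exists A, T A = B by case: T_bij => g _ Kg; exists (g B).
case: T_form => TE.
  have TleL : strongly_preserves T (@green_leL S n).
    by move=> A B; rewrite !TE; apply: green_leL_equivalence.
  have TleR : strongly_preserves T (@green_leR S n).
    by move=> A B; rewrite !TE; apply: green_leR_equivalence.
  have [two_sided [TL TR]] := strongly_preserves_green T_onto TleL TleR.
  by split=> //; left.
have Tle : strongly_exchanges T (@green_leL S n) (@green_leR S n).
  move=> A B; rewrite !TE -(green_leR_tr A B) -(green_leL_tr A B).
  by split; [apply: green_leR_equivalence | apply: green_leL_equivalence].
have [two_sided TLR] := strongly_exchanges_green T_onto Tle.
by split=> //; right.
Qed.
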